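(* Let $\xi$ be an approximate design whose information matrix $\mathbf{M}(\xi)$ is non-singular. Then the E-criterion for the prediction of individual parameters, $\Phi_E(\xi)$, defined as the largest eigenvalue of $\mathrm{MSE}(\xi)$, is given by $$\Phi_E(\xi)=\eta_{\max}(\xi),$$ where $\eta_{\max}(\xi)$ denotes the largest eigenvalue of $\mathbf{M}(\xi)^{-1}$.
   Context: Random coefficients regression model: $Y_{ij}=\mathbf{f}(x_j)^\top\boldsymbol{\beta}_i+\varepsilon_{ij}$, $j=1,\dots,m$, $i=1,\dots,n$, with $m,n\ge 1$, experimental region $\mathcal{X}$, known regression functions $\mathbf{f}=(f_1,\dots,f_p)^\top:\mathcal{X}\to\mathbb{R}^p$, uncorrelated zero-mean errors of variance $\sigma^2>0$, and individual parameters $\boldsymbol{\beta}_i$ with unknown mean and $\mathrm{Cov}(\boldsymbol{\beta}_i)=\sigma^2\mathbf{D}$, where $\mathbf{D}$ is a known (symmetric) positive definite $p\times p$ matrix. Put $\mathbf{\Delta}=m\,\mathbf{D}$. An approximate design $\xi$ consists of finitely many distinct points $x_1,\dots,x_k\in\mathcal{X}$ with weights $w_j\ge 0$, $\sum_{j=1}^k w_j=1$. Its (fixed effects, standardized) information matrix is $\mathbf{M}(\xi)=\sum_{j=1}^k w_j\,\mathbf{f}(x_j)\mathbf{f}(x_j)^\top$, assumed non-singular. The (standardized) mean squared error matrix for the best linear unbiased prediction of $(\boldsymbol{\beta}_1^\top,\dots,\boldsymbol{\beta}_n^\top)^\top$ is the $np\times np$ matrix $$\mathrm{MSE}(\xi)=\tfrac1n\left(\mathbf{1}_n\mathbf{1}_n^\top\right)\otimes\mathbf{M}(\xi)^{-1}+\left(\mathbf{I}_n-\tfrac1n\mathbf{1}_n\mathbf{1}_n^\top\right)\otimes\left(\mathbf{M}(\xi)+\mathbf{\Delta}^{-1}\right)^{-1},$$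 where $\mathbf{1}_n$ is the all-ones vector of length $n$, $\mathbf{I}_n$ the identity matrix, and $\otimes$ the Kronecker product. *)

(* Defs.v *)
From mathcomp Require Import all_boot all_order all_algebra.
From mathcomp Require Import complex mxtens polyrcf spectral.
From mathcomp Require Import classical_sets reals.

Set Implicit Arguments.
Unset Strict Implicit.
Unset Printing Implicit Defensive.

Import Order.TTheory GRing.Theory Num.Theory.
Local Open Scope ring_scope.
Local Open Scope classical_set_scope.

Section MaxEigenvalue.
Variable R : realType.

(* A matrix has finitely many eigenvalues, so this supremum is a maximum as
   soon as one eigenvalue exists in R, in particular for every non-empty
   symmetric matrix: see max_eigenvalueP below. *)
Definition max_eigenvalue (p : nat) (A : 'M[R]_p) : R :=
  sup [set l | eigenvalue A l].

Lemma eigenvalue_sym_exists (p : nat) (A : 'M[R]_p) :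
  (0 < p)%N -> A^T = A -> exists l, eigenvalue A l.
Proof.
move=> p_gt0 A_sym; pose AC := map_mx (@real_complex R) A.
have [a a_eig] := eigenvalue_closed AC p_gt0.
have [v vA v_neq0] := eigenvalueP a_eig.
pose q : R[i] := \sum_j `|v 0 j| ^+ 2.
have q_neq0 : q != 0.
  apply: contra v_neq0 => /eqP q0; apply/eqP/rowP => j; rewrite mxE.
  have /(_ j isT)/eqP := psumr_eq0P (fun j _ => exprn_ge0 2 (normr_ge0 (v 0 j))) q0.
  by rewrite sqrf_eq0 normr_eq0 => /eqP.
have vE j : \sum_k v 0 k * AC k j = a * v 0 j.
  by have /rowP/(_ j) := vA; rewrite !mxE.
have ACs j k : AC j k = AC k j by rewrite !mxE -{1}A_sym mxE.
have ACr j k : (AC j k)^* = AC j k.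
  by rewrite mxE; apply/CrealP; rewrite complex_real.
have aq : a * q = \sum_j \sum_k v 0 k * AC k j * (v 0 j)^*.
  rewrite mulr_sumr; apply: eq_bigr => j _.
  by rewrite normCK mulrA -vE mulr_suml.
have aqC : (a * q)^* = a * q.
  rewrite aq rmorph_sum exchange_big /=; apply: eq_bigr => j _.
  rewrite rmorph_sum /=; apply: eq_bigr => k _.
  by rewrite !rmorphM /= conjCK ACr ACs mulrC mulrA mulrAC.
have a_real : a \is Num.real.
  apply/CrealP; move: aqC; rewrite rmorphM /=.
  have /CrealP -> : q \is Num.real.
    by apply: rpred_sum => j _; apply: ger0_real; apply: exprn_ge0.
  exact: (mulIf q_neq0).
exists (complex.Re a); rewrite eigenvalue_root_char -(fmorph_root (real_complex R)).
rewrite map_char_poly -eigenvalue_root_char.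
by move: a_eig; rewrite -{1}(RRe_real a_real).
Qed.

Lemma max_eigenvalueP (p : nat) (A : 'M[R]_p) : (0 < p)%N -> A^T = A ->
  eigenvalue A (max_eigenvalue A) /\
  forall l, eigenvalue A l -> l <= max_eigenvalue A.
Proof.
move=> p_gt0 A_sym; have [l0 l0_eig] := eigenvalue_sym_exists p_gt0 A_sym.
have [s sP] : exists s : seq R, forall l, eigenvalue A l -> l \in s.
  have cA_neq0 : char_poly A != 0 by rewrite monic_neq0 ?char_poly_monic.
  exists (rootsR (char_poly A)) => l; rewrite eigenvalue_root_char => Al.
  by have /(_ l) := roots_onP (roots_on_rootsR cA_neq0); rewrite in_itv /= Al => <-.
pose t := [seq l <- s | eigenvalue A l].
have tE l : (l \in t) = eigenvalue A l.
  by rewrite mem_filter andb_idr // => /sP.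
pose m := \big[Order.max/l0]_(l <- t) l.
have m_ub l : eigenvalue A l -> l <= m.
  by rewrite -tE => lt; apply: le_bigmax_seq.
have m_eig : eigenvalue A m.
  rewrite /m big_seq; elim/big_ind: _ => //.
    by move=> x y Ax Ay; rewrite /Order.max; case: ifP.
  by move=> l; rewrite tE.
suff -> : max_eigenvalue A = m by [].
apply/eqP; rewrite eq_le ge_sup ?ub_le_sup //=; last by exists m.
by exists m.
Qed.
End MaxEigenvalue.

Definition posdefmx (R : realType) (p : nat) (A : 'M[R]_p) : Prop :=
  A^T = A /\ forall v : 'cV[R]_p, v != 0 -> 0 < (v^T *m A *m v) 0 0.

Record design (R : realType) (X : Type) : Type := Design {
  design_size : nat;
  design_point : 'I_design_size -> X;
  design_weight : 'I_design_size -> R;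
  design_point_inj : injective design_point;
  design_weight_ge0 : forall j, 0 <= design_weight j;
  design_weight_sum : \sum_j design_weight j = 1 }.

Arguments design_point {R X} d j.
Arguments design_weight {R X} d j.

Section Criterion.
Variables (R : realType) (X : Type).

Definition infomx (p : nat) (f : X -> 'cV[R]_p) (xi : design R X) : 'M[R]_p :=
  \sum_j design_weight xi j *:
    (f (design_point xi j) *m (f (design_point xi j))^T).

(* Standardized MSE matrix of the BLUP of the n individual parameters, with m
   observations per individual and Cov(beta_i) = sigma^2 D; Delta = m D. *)
Definition mse (p : nat) (f : X -> 'cV[R]_p) (m n : nat) (D : 'M[R]_p)
    (xi : design R X) : 'M[R]_(n * p) :=
  let M := infomx f xi in
  let Delta := m%:R *: D in
  let J : 'M[R]_n := n%:R^-1 *: (const_mx 1 *m (const_mx 1 : 'cV[R]_n)^T) in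
  J *t invmx M + (1%:M - J) *t invmx (M + invmx Delta).

Definition Phi_E (p : nat) (f : X -> 'cV[R]_p) (m n : nat) (D : 'M[R]_p)
    (xi : design R X) : R :=
  max_eigenvalue (mse f m n D xi).

Definition eta_max (p : nat) (f : X -> 'cV[R]_p) (xi : design R X) : R :=
  max_eigenvalue (invmx (infomx f xi)).

Lemma infomx_sym (p : nat) (f : X -> 'cV[R]_p) (xi : design R X) :
  (infomx f xi)^T = infomx f xi.
Proof.
rewrite /infomx raddf_sum; apply: eq_bigr => j _.
by rewrite /= linearZ /= trmx_mul trmxK.
Qed.

Lemma mse_sym (p : nat) (f : X -> 'cV[R]_p) (m n : nat) (D : 'M[R]_p)
    (xi : design R X) : D^T = D -> (mse f m n D xi)^T = mse f m n D xi.
Proof.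
move=> D_sym; rewrite /mse linearD /= !trmx_tens !linearB /= !linearZ /=.
by rewrite trmx_mul trmxK trmx1 !trmx_inv linearD /= trmx_inv linearZ /= D_sym infomx_sym.
Qed.

End Criterion.

(* Main.v *)
(* If a is the largest eigenvalue of M^-1, then M >= a^-1 by Rayleigh's
   principle, hence M + Delta^-1 >= a^-1 and no eigenvalue of
   (M + Delta^-1)^-1 exceeds a.  As J = 1 1^T / n is a projection, an
   eigenvector u of MSE splits into u (J *t 1) and u ((1 - J) *t 1), which are
   (if non-zero) eigenvectors of 1 *t M^-1 and of 1 *t (M + Delta^-1)^-1 for
   the same eigenvalue.  Conversely, if v M^-1 = a v then 1^T *t v is an
   eigenvector of MSE for a. *)
Require Import Defs.
From mathcomp Require Import all_boot all_order all_algebra.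
From mathcomp Require Import complex mxtens spectral.
From mathcomp Require Import reals.

Set Implicit Arguments.
Unset Strict Implicit.
Unset Printing Implicit Defensive.

Import Order.TTheory GRing.Theory Num.Theory.
Local Open Scope ring_scope.

(** Over [R[i]] the symmetric [A] is Hermitian, hence unitarily diagonalisable. In coordinates [y]
    along an eigenbasis both sides are sums of [|y_i|^2], weighted by [c] on the left and by the
    eigenvalues on the right. *)
Lemma rayleigh_min (R : rcfType) (p : nat) (A : 'M[R]_p) (c : R) :
    A^T = A -> (forall l, eigenvalue A l -> c <= l) ->
  forall x : 'rV_p, c * (x *m x^T) 0 0 <= (x *m A *m x^T) 0 0.
Proof.
move=> A_sym A_ge x; set r := real_complex R.
have rE (k : nat) (B : 'M[R]_(k, p)) : (map_mx r B ^t*)%sesqui = map_mx r B^T.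
  apply/matrixP=> i j; rewrite !mxE; apply/CrealP.
  by rewrite complex_real.
pose AC := map_mx r A.
have AC_herm : AC \is hermsymmx.
  by apply/is_hermitianmxP; rewrite scale1r rE A_sym.
have d_real := hermitian_spectral_diag_real AC_herm.
have /orthomx_spectralP := hermitian_normalmx AC_herm.
have P_unitary := spectral_unitarymx AC.
have P_unit := spectral_unit AC.
move: d_real P_unitary P_unit.
set P := spectralmx AC; set d := spectral_diag AC.
move=> /mxOverP d_real P_unitary P_unit AC_E.
(* Row [i] of [P] is a left eigenvector of [AC] for [d 0 i]. This number is real, so through the
   characteristic polynomial it is an eigenvalue of [A] itself. *)
have d_ge i : r c <= d 0 i.
  have d_eig : eigenvalue AC (d 0 i).
    apply/eigenvalueP; exists (row i P); last first.
      rewrite rowE; apply/eqP => eP0.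
      have /rowP/(_ i) := congr1 (mulmx^~ (invmx P)) eP0.
      by rewrite mulmxK // mul0mx !mxE !eqxx => /eqP; rewrite oner_eq0.
    rewrite AC_E -row_mul !mulmxA mulmxV // mul1mx.
    by rewrite row_mul row_diag_mx -scalemxAl -rowE.
  rewrite -(RRe_real (d_real 0 i)) lecR; apply: A_ge.
  rewrite eigenvalue_root_char -(fmorph_root r) map_char_poly.
  rewrite -eigenvalue_root_char /=.
  by rewrite [X in eigenvalue _ X](RRe_real (d_real 0 i)).
pose y := map_mx r x *m (P ^t*)%sesqui.
have xE : map_mx r x = y *m P by rewrite /y mulmxKtV.
have xtE : map_mx r x^T = (P ^t*)%sesqui *m (y ^t*)%sesqui.
  by rewrite -rE xE trmx_mul map_mxM.
have AC_PE : AC = (P ^t*)%sesqui *m diag_mx d *m P.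
  by rewrite AC_E invmx_unitary.
have mapE (B : 'M[R]_1) : r (B 0 0) = (map_mx r B) 0 0 by rewrite mxE.
suff: r c * r ((x *m x^T) 0 0) <= r ((x *m A *m x^T) 0 0).
  by rewrite -[r c * _](rmorphM (real_complex R)) lecR.
rewrite !mapE !map_mxM /= -/AC xtE xE AC_PE.
rewrite !mulmxA !mulmxtVK // !mxE mulr_sumr ler_sum // => i _.
rewrite mul_mx_diag !mxE -normCK mulrAC -normCK mulrC.
by rewrite ler_wpM2l // exprn_ge0.
Qed.

Section PsdInverse.
Variables (R : realType) (p : nat).
Implicit Types (A B M : 'M[R]_p) (x : 'rV[R]_p).

Lemma row_normsq_gt0 x : x != 0 -> 0 < (x *m x^T) 0 0.
Proof.
case/rV0Pn => j xj; rewrite mxE (bigD1 j) //= mxE.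
by rewrite ltr_pwDl // ?sumr_ge0 // -?expr2 ?exprn_even_gt0 // => k _;
  rewrite mxE -expr2 sqr_ge0.
Qed.

Definition psdmx A := forall x, 0 <= (x *m A *m x^T) 0 0.

(** By symmetry, the form of the inverse at [x] is the form of [A] at [x *m invmx A]. *)
Lemma psdmx_inv A : A^T = A -> psdmx A -> psdmx (invmx A).
Proof.
move=> A_sym A_psd x; have [A_unit | A_nunit] := boolP (A \in unitmx).
  have := A_psd (x *m invmx A).
  by rewrite mulmxKV // trmx_mul trmx_inv A_sym mulmxA.
(* [invmx] leaves a singular matrix unchanged. *)
by rewrite invmx_out.
Qed.

Lemma eigenvalue_inv A l :
  A \in unitmx -> eigenvalue A l -> l != 0 /\ eigenvalue (invmx A) l^-1.
Proof.
move=> A_unit /eigenvalueP[v vA v_neq0].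
have l_neq0 : l != 0.
  by apply: contraNneq v_neq0 => l0; rewrite -(mulmxK A_unit v) vA l0 scale0r mul0mx.
split=> //; apply/eigenvalueP; exists v => //.
by rewrite -[v in RHS](mulmxK A_unit) vA -scalemxAl scalerA mulVf // scale1r.
Qed.

(* Antitonicity of the inverse on positive definite matrices, for the top
   eigenvalue only. *)
Lemma eigenvalue_invD_le M B l : M^T = M -> psdmx M -> M \in unitmx ->
    psdmx B -> (0 < p)%N ->
  eigenvalue (invmx (M + B)) l -> l <= max_eigenvalue (invmx M).
Proof.
move=> M_sym M_psd M_unit B_psd p_gt0.
have [] := @max_eigenvalueP _ _ (invmx M) p_gt0 _.
  by rewrite trmx_inv M_sym.
set a := max_eigenvalue _ => a_eig a_max.
have M_eig_gt0 k : eigenvalue M k -> 0 < k.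
  move=> /[dup] /(eigenvalue_inv M_unit)[k_neq0 _] /eigenvalueP[v vM v_neq0].
  have := M_psd v; rewrite vM -scalemxAl mxE pmulr_lge0 ?row_normsq_gt0 //.
  by rewrite le0r (negPf k_neq0).
have a_gt0 : 0 < a.
  have [|_] := eigenvalue_inv _ a_eig; first by rewrite unitmx_inv.
  by rewrite invmxK => /M_eig_gt0; rewrite invr_gt0.
(* Eigenvalues of [M] are reciprocals of eigenvalues of its inverse, hence at least [a^-1]. *)
have M_ge x : a^-1 * (x *m x^T) 0 0 <= (x *m M *m x^T) 0 0.
  apply: rayleigh_min => // k k_eig; have k_gt0 := M_eig_gt0 _ k_eig.
  have [_ /a_max] := eigenvalue_inv M_unit k_eig.
  by rewrite -[k in _ -> _ <= k]invrK lef_pV2 ?posrE ?invr_gt0.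
have MB_ge x : a^-1 * (x *m x^T) 0 0 <= (x *m (M + B) *m x^T) 0 0.
  rewrite mulmxDr mulmxDl [in leRHS]mxE -[leLHS]addr0.
  by rewrite lerD ?M_ge ?B_psd.
(* A non-zero row in the kernel would make the form of [M + B] vanish, against [MB_ge]. *)
have MB_unit : M + B \in unitmx.
  rewrite -row_free_unit -kermx_eq0; apply/rowV0P => v /sub_kermxP vMB.
  have := MB_ge v; rewrite vMB mul0mx [in leRHS]mxE.
  apply: contraTeq => v_neq0.
  by rewrite -ltNge mulr_gt0 ?invr_gt0 ?row_normsq_gt0.
move=> l_eig.
have [|_] := eigenvalue_inv _ l_eig; first by rewrite unitmx_inv.
rewrite invmxK => /eigenvalueP[v vMB v_neq0].
have := MB_ge v; rewrite vMB -scalemxAl [in leRHS]mxE.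
rewrite ler_pM2r ?row_normsq_gt0 // => al.
have l_gt0 : 0 < l by rewrite -invr_gt0 (lt_le_trans _ al) ?invr_gt0.
by rewrite -lef_pV2 ?posrE.
Qed.

End PsdInverse.

(** Cut [u] into [n] blocks of length [p]: the matrix acts on each block by [A] separately, so any
    non-zero block is an eigenvector of [A]. *)
Lemma eigenvalue_tens1 (F : fieldType) (n p : nat) (A : 'M[F]_p) (l : F) :
  eigenvalue ((1%:M : 'M_n) *t A) l -> eigenvalue A l.
Proof.
case/eigenvalueP => u uA /rV0Pn[k uk_neq0].
move: uk_neq0; rewrite -[k]mxtens_unindexK.
case: (mxtens_unindex k) => i j uij_neq0.
apply/eigenvalueP; exists (\row_j u 0 (mxtens_index (i, j))); last first.
  by apply/rV0Pn; exists j; rewrite mxE.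
apply/rowP => h; have /rowP/(_ (mxtens_index (i, h))) := uA.
rewrite mxE [in RHS]mxE => uAih; rewrite [in RHS]mxE mxE -uAih.
(* Summing over pairs of indices, the identity factor keeps only block [i]. *)
rewrite (reindex (@mxtens_index n p)) /=; last first.
  by exists (@mxtens_unindex n p) => ? _; rewrite ?mxtens_indexK ?mxtens_unindexK.
rewrite (eq_bigr (fun ij => u 0 (mxtens_index (ij.1, ij.2))
  * (1%:M *t A) (mxtens_index (ij.1, ij.2)) (mxtens_index (i, h)))); last by case.
rewrite -(pair_bigA _ (fun i' j' => u 0 (mxtens_index (i', j'))
  * (1%:M *t A) (mxtens_index (i', j')) (mxtens_index (i, h)))) /=.
rewrite (bigD1 i) //= [X in _ + X]big1 ?addr0 => [|i' i'i].
  by rewrite mxE; apply: eq_bigr => j' _; rewrite tensmxE !mxE eqxx mul1r.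
by apply: big1 => j' _; rewrite tensmxE mxE (negPf i'i) mul0r mulr0.
Qed.

Section TensProjection.
Variables (F : fieldType) (n p : nat) (J : 'M[F]_n) (A B : 'M[F]_p).

Lemma eigenvalue_tens_proj l :
    J *m J = J -> eigenvalue (J *t A + (1%:M - J) *t B) l ->
  eigenvalue A l \/ eigenvalue B l.
Proof.
move=> J_idem /eigenvalueP[u]; set S := (_ + _) => uS u_neq0.
have J_idemC : (1%:M - J) *m (1%:M - J) = 1%:M - J.
  by rewrite mulmxBl mul1mx mulmxBr mulmx1 J_idem subrr subr0.
have JJC : J *m (1%:M - J) = 0 by rewrite mulmxBr mulmx1 J_idem subrr.
have JCJ : (1%:M - J) *m J = 0 by rewrite mulmxBl mul1mx J_idem subrr.
(* Both sides equal [J *t A], so [J *t 1%:M] sends an eigenvector of [S] to zero or to an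
   eigenvector of [1%:M *t A]. *)
have SJ : (J *t 1%:M) *m (1%:M *t A) = S *m (J *t 1%:M).
  by rewrite mulmxDl !tensmx_mul J_idem JCJ tens0mx addr0 !mulmx1 mul1mx.
have SJC : ((1%:M - J) *t 1%:M) *m (1%:M *t B) = S *m ((1%:M - J) *t 1%:M).
  by rewrite mulmxDl !tensmx_mul J_idemC JJC tens0mx add0r !mulmx1 mul1mx.
have [uJ0 | uJ_neq0] := eqVneq (u *m (J *t 1%:M)) 0; last first.
  left; apply/(@eigenvalue_tens1 _ n)/eigenvalueP; exists (u *m (J *t 1%:M)) => //.
  by rewrite -mulmxA SJ mulmxA uS scalemxAl.
right; apply/(@eigenvalue_tens1 _ n)/eigenvalueP.
exists (u *m ((1%:M - J) *t 1%:M)); last first.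
  apply: contra_neq u_neq0 => uJC0.
  have J_split : J *t 1%:M + (1%:M - J) *t 1%:M = 1%:M :> 'M[F]_(n * p).
    (* Entrywise, a product of two Kronecker deltas is the delta of the paired index. *)
    apply/matrixP => a b; rewrite !mxE -mulrDl (addrC (J _ _)) subrK -natrM mulnb.
    by rewrite -xpair_eqE -!surjective_pairing (can_eq (@mxtens_unindexK n p)).
  by rewrite -[u]mulmx1 -J_split mulmxDr uJ0 uJC0 addr0.
by rewrite -mulmxA SJC mulmxA uS scalemxAl.
Qed.

(** A row fixed by [J] is killed by [1%:M - J], so only [A] acts on [w *t v]. *)
Lemma eigenvalue_tens_proj_fixed (w : 'rV[F]_n) l :
    w *m J = w -> w != 0 -> eigenvalue A l ->
  eigenvalue (J *t A + (1%:M - J) *t B) l.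
Proof.
move=> wJ /rV0Pn[i wi] /eigenvalueP[v vA /rV0Pn[j vj]].
have wvS : (w *t v) *m (J *t A + (1%:M - J) *t B) = l *: (w *t v).
  rewrite mulmxDr !tensmx_mul mulmxBr mulmx1 wJ subrr tens0mx addr0 vA.
  by apply/matrixP => a b; rewrite !mxE mulrCA.
apply/eigenvalueP; exists (w *t v : 'rV_(n * p)) => //.
apply/rV0Pn; exists (mxtens_index (i, j)).
by rewrite !mxE mxtens_indexK /= !ord1 mulf_neq0.
Qed.

End TensProjection.

Theorem theorem2 (R : realType) (X : Type) (p m n : nat)
    (hp : (0 < p)%N) (hm : (0 < m)%N) (hn : (0 < n)%N)
    (f : X -> 'cV[R]_p) (D : 'M[R]_p) (hD : posdefmx D)
    (xi : design R X) (hM : infomx f xi \in unitmx) :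
  Phi_E f m n D xi = eta_max f xi.
Proof.
case: hD => D_sym D_pos; rewrite /Phi_E /eta_max.
have np_gt0 : (0 < n * p)%N by rewrite muln_gt0 hn.
have [mse_eig mse_max] := max_eigenvalueP np_gt0 (mse_sym f m n xi D_sym).
move: mse_eig mse_max; set b := max_eigenvalue (mse _ _ _ _ _).
rewrite /mse; set M := infomx f xi; set Delta := m%:R *: D.
set J : 'M[R]_n := _ *: _ => mse_eig mse_max.
have M_sym : M^T = M := infomx_sym f xi.
have [|a_eig a_max] := @max_eigenvalueP _ _ (invmx M) hp _.
  by rewrite trmx_inv M_sym.
(* The form of [M] at [x] is the weighted sum of the squares of [x *m f (design_point xi j)]. *)
have M_psd : psdmx M.
  move=> x; rewrite /M /infomx mulmx_sumr mulmx_suml summxE sumr_ge0 // => j _.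
  rewrite -scalemxAr -scalemxAl mxE mulr_ge0 ?design_weight_ge0 //.
  rewrite mulmxA -(mulmxA (x *m _)) -trmx_mul.
  by rewrite mxE big_ord1 [in X in _ * X]mxE -expr2 sqr_ge0.
have Delta_psd : psdmx (invmx Delta).
  apply: psdmx_inv; first by rewrite linearZ /= D_sym.
  move=> x; rewrite -scalemxAr -scalemxAl mxE mulr_ge0 //.
  have [-> | x_neq0] := eqVneq x 0; first by rewrite !mul0mx mxE.
  by have := D_pos x^T; rewrite trmxK trmx_eq0 => /(_ x_neq0)/ltW.
have n_neq0 : n%:R != 0 :> R by rewrite pnatr_eq0 -lt0n.
(* Columns of [J] sum to [n * n^-1 = 1]. This gives both the fixed row needed for the lower bound
   and the idempotence of [J]. *)
have oneJ : (const_mx 1 : 'rV_n) *m J = const_mx 1.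
  rewrite -scalemxAr mulmxA trmx_const; apply/rowP => i.
  by rewrite !mxE big_ord1 !mxE; under eq_bigr do rewrite !mxE mulr1;
    rewrite sumr_const card_ord mulr1 mulVf.
have J_idem : J *m J = J.
  by rewrite {1}/J -scalemxAl -mulmxA trmx_const oneJ /J trmx_const.
(* Upper bound: [b] is itself an eigenvalue, of one of the two inverses. Lower bound: the top
   eigenvalue of [invmx M] occurs in the MSE matrix. *)
apply/eqP; rewrite eq_le; apply/andP; split.
  have [/a_max // |] := eigenvalue_tens_proj J_idem mse_eig.
  exact: eigenvalue_invD_le.
apply: mse_max; apply: eigenvalue_tens_proj_fixed oneJ _ a_eig.
apply/rV0Pn; exists (Ordinal hn); rewrite mxE; exact: oner_neq0.
Qed.
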